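(* Let $G$ be a group and $\mathbb{K}\in\{\mathbb{R},\mathbb{C}\}$. If $W:G\times G\to\mathcal{M}_d(\mathbb{K})$ is a partial cotranslation whose projector of the units space and its complement are uniformly bounded, i.e. there exists $M\geq1$ such that $$\sup_{g\in G}\left\{\|W(g,e)\|,\|\mathrm{Id}-W(g,e)\|\right\}<M,$$ then $W$ is boundedly conjugated to a partial cotranslation whose units space projector is constant and orthogonal.
   Context: $e$ is the unit of $G$; $\mathcal{M}_d(\mathbb{K})$ is the space of $d\times d$ matrices over $\mathbb{K}$, with the operator norm induced by the Euclidean norm on $\mathbb{K}^d$; $GL_d(\mathbb{K})$ is the general linear group. A function $W:G\times G\to\mathcal{M}_d(\mathbb{K})$ is a partial cotranslation if $W(g,kh)=W(hg,k)W(g,h)$ for all $g,h,k\in G$. The rank of $W(g,h)$ does not depend on $(g,h)$, and $\mathrm{rank}\,W$ denotes this common value. The projector of the units space of $W$ is the map $g\mapsto W(g,e)$; it is called constant and orthogonal if $W(g,e)=\begin{pmatrix}\mathrm{Id}_{\mathrm{rank}\,W}&0\\0&0\end{pmatrix}$ for all $g\in G$. Two partial cotranslations $W,V$ are boundedly conjugated if there is a map $T:G\to GL_d(\mathbb{K})$ such that $T(hg)V(g,h)=W(g,h)T(g)$ for all $g,h\in G$ and $\sup_{g\in G}\{\|T(g)\|,\|T(g)^{-1}\|\}<\infty$. *)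

(* Defs.v *)
From HB Require Import structures.
From mathcomp Require Import all_boot all_order all_algebra.
From mathcomp Require Import complex.
From mathcomp Require Import classical_sets reals constructive_ereal ereal.

Set Implicit Arguments.
Unset Strict Implicit.
Unset Printing Implicit Defensive.

Import Order.TTheory GRing.Theory Num.Theory.
Local Open Scope classical_set_scope.
Local Open Scope ring_scope.

Variant scalar_kind := RealScalars | ComplexScalars.

Definition scalars (R : realType) (k : scalar_kind) : numFieldType :=
  match k with
  | RealScalars => R
  | ComplexScalars => R[i]%C
  end.

(* The library norm on [R[i]] takes its values in [R[i]]; [Re] brings it back
   to [R]. *)
Definition modulus (R : realType) (k : scalar_kind) : scalars R k -> R :=
  match k with
  | RealScalars => fun x : R => `|x|
  | ComplexScalars => fun z : R[i]%C => complex.Re `|z|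
  end.

Definition euclidean_norm (R : realType) (k : scalar_kind) (d : nat)
    (v : 'cV[scalars R k]_d) : R :=
  Num.sqrt (\sum_(i < d) modulus (v i 0) ^+ 2).

(* Not the library norm [`|A|] on matrices, which is the entrywise maximum. *)
Definition operator_norm (R : realType) (k : scalar_kind) (d : nat)
    (A : 'M[scalars R k]_d) : R :=
  sup [set euclidean_norm (A *m v) | v in [set v | euclidean_norm v <= 1]].

Lemma modulusM (R : realType) (k : scalar_kind) (x y : scalars R k) :
  modulus (x * y) = modulus x * modulus y.
Proof.
case: k x y => x y; first exact: (@normrM R).
by rewrite /modulus (normrM (x : R[i]%C) y) !normc_def -rmorphM.
Qed.

Lemma ler_modulusD (R : realType) (k : scalar_kind) (x y : scalars R k) :
  modulus (x + y) <= modulus x + modulus y.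
Proof.
case: k x y => x y; first exact: (@ler_normD R R).
by have := ler_normD (x : R[i]%C) y; rewrite /modulus !normc_def -rmorphD lecR.
Qed.

Lemma modulus0 (R : realType) (k : scalar_kind) :
  modulus (0 : scalars R k) = 0.
Proof.
case: k; first exact: (@normr0 R R).
by rewrite /modulus (normr0 R[i]%C).
Qed.

Lemma modulus_ge0 (R : realType) (k : scalar_kind) (x : scalars R k) :
  0 <= modulus x.
Proof.
case: k x => x; first exact: (@normr_ge0 R R).
by rewrite /modulus normc_def sqrtr_ge0.
Qed.

(* The supremum defining [operator_norm] is thus never the default value that
   [sup] takes on empty or unbounded sets. *)
Lemma operator_norm_has_sup (R : realType) (k : scalar_kind) (d : nat)
    (A : 'M[scalars R k]_d) :
  has_sup [set euclidean_norm (A *m v) | v in [set v | euclidean_norm v <= 1]].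
Proof.
split.
  exists (euclidean_norm (A *m 0)), 0 => //=.
  rewrite /euclidean_norm big1 ?sqrtr0// => i _.
  by rewrite mxE modulus0 expr0n.
exists (Num.sqrt (\sum_i (\sum_j modulus (A i j)) ^+ 2)) => _ [v /= v1 <-].
have vj j : modulus (v j 0) <= 1.
  apply: le_trans v1; rewrite -[leLHS]ger0_norm ?modulus_ge0// -sqrtr_sqr.
  rewrite ler_wsqrtr// (bigD1 j)//= lerDl.
  by apply: sumr_ge0 => i _; exact: sqr_ge0.
rewrite ler_wsqrtr//; apply: ler_sum => i _.
rewrite lerXn2r ?nnegrE ?modulus_ge0 ?sumr_ge0//.
  by move=> j _; exact: modulus_ge0.
rewrite mxE; apply: (@le_trans _ _ (\sum_j modulus (A i j * v j 0))).
  elim/big_rec2: _ => [|j x y _ le_yx]; first by rewrite modulus0.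
  by apply: le_trans (ler_modulusD _ _) _; rewrite lerD2l.
apply: ler_sum => j _; rewrite modulusM ler_piMr// ?modulus_ge0//.
Qed.

Definition partial_cotranslation (G : groupType) (K : fieldType) (d : nat)
    (W : G -> G -> 'M[K]_d) : Prop :=
  forall g h k : G, W g (k * h)%g = W (h * g)%g k *m W g h.

Definition cotranslation_rank (G : groupType) (K : fieldType) (d : nat)
    (W : G -> G -> 'M[K]_d) : nat :=
  \rank (W 1%g 1%g).

Lemma cotranslation_rankE (G : groupType) (K : fieldType) (d : nat)
    (W : G -> G -> 'M[K]_d) :
  partial_cotranslation W -> forall g h : G, \rank (W g h) = cotranslation_rank W.
Proof.
move=> cW.
have le1 g h h' : (\rank (W g h') <= \rank (W g h))%N.
  by rewrite -[h'](mulgVK h) cW mxrankM_maxr.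
have le2 g g' h k : (\rank (W g h) <= \rank (W g' k))%N.
  apply: (leq_trans (le1 g (k * (g' * g^-1))%g h)).
  by rewrite cW mulgVK mxrankM_maxl.
by move=> g h; apply/eqP; rewrite eqn_leq !le2.
Qed.

Definition constant_orthogonal_projector (G : groupType) (K : fieldType)
    (d : nat) (W : G -> G -> 'M[K]_d) : Prop :=
  forall g : G, W g 1%g = pid_mx (cotranslation_rank W).

Definition boundedly_conjugated (G : groupType) (R : realType)
    (k : scalar_kind) (d : nat) (W V : G -> G -> 'M[scalars R k]_d) : Prop :=
  exists T : G -> 'M[scalars R k]_d,
    [/\ forall g : G, T g \in unitmx,
        forall g h : G, T (h * g)%g *m V g h = W g h *m T g
      & (ereal_sup (range (fun g => (operator_norm (T g))%:E)
                    `|` range (fun g => (operator_norm (invmx (T g)))%:E))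
         < +oo)%E].

(* Main.v *)
(* Let P = W(g,e), an idempotent.  Choosing the r x r minor of P of largest
   modulus, r = rank P, Cramer's rule gives a rank factorization P = U C where
   the columns of U are columns of P and the entries of C have modulus at most
   1; likewise Id - P = U' C'.  Then T = (U | U') has inverse (C ; C'), it
   conjugates P to diag(Id_r, 0), and both T and its inverse have entries
   bounded in terms of the norms of P and Id - P only.  One takes
   V(g,h) = T(hg)^-1 W(g,h) T(g). *)
Require Import Defs.
From mathcomp Require Import all_boot all_order all_algebra.
From mathcomp Require Import complex boolp.
From mathcomp Require Import classical_sets reals constructive_ereal ereal.
Import Order.TTheory GRing.Theory Num.Theory.
Local Open Scope classical_set_scope.
Local Open Scope ring_scope.

(** Choose a basis of the row space among the rows; the resulting matrix has full row rank, so a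
    second choice, made on its transpose, extracts an invertible square block. *)
Lemma full_rank_minor {K : fieldType} {m n : nat} (A : 'M[K]_(m, n)) :
  exists (f : 'I_(\rank A) -> 'I_m) (g : 'I_(\rank A) -> 'I_n),
    mxsub f g A \in unitmx.
Proof.
have fullB : row_full (rowsub (maxrankfun A) A)^T.
  by rewrite /row_full mxrank_tr eq_maxrowsub.
exists (maxrankfun A), (fullrankfun fullB); rewrite -unitmx_tr.
rewrite (_ : _^T = rowsub (fullrankfun fullB) (rowsub (maxrankfun A) A)^T).
  exact: fullrowsub_unit.
by apply/matrixP => i j; rewrite !mxE.
Qed.

(** The rows picked by [f] contain an invertible block of size [\rank A], so they span the row space
    and [A = X *m rowsub f A]. Restricting to the columns [g] determines [X]. *)
Lemma rank_factorization_of_minor {K : fieldType} {m n : nat}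
    (A : 'M[K]_(m, n)) (f : 'I_(\rank A) -> 'I_m) (g : 'I_(\rank A) -> 'I_n) :
  mxsub f g A \in unitmx ->
  colsub g A *m (invmx (mxsub f g A) *m rowsub f A) = A.
Proof.
move=> uB; have subfg : mxsub f g A = colsub g (rowsub f A).
  by apply/matrixP => i j; rewrite !mxE.
have colsubM p q (X : 'M[K]_(p, q)) (Y : 'M[K]_(q, n)) :
    colsub g (X *m Y) = X *m colsub g Y.
  by apply/matrixP => i j; rewrite !mxE; apply: eq_bigr => l _; rewrite !mxE.
have sAf : (A <= rowsub f A)%MS.
  have [_ <-] := mxrank_leqif_sup (rowsub_sub f A).
  rewrite eqn_leq mxrankS ?rowsub_sub//=.
  have {1}<- : \rank (mxsub f g A) = \rank A by apply: mxrank_unit.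
  have -> : mxsub f g A = rowsub f A *m colsub g 1%:M.
    by rewrite -colsubM mulmx1.
  exact: mxrankM_maxl.
have /submxP[X AX] := sAf.
have -> : colsub g A = X *m mxsub f g A by rewrite subfg -colsubM -AX.
by rewrite mulmxA mulmxK.
Qed.

(** Expand the right-hand determinant along column [i]: only that column was replaced, so its
    cofactors are those of the original minor. *)
Lemma cramer_mxsub {K : fieldType} {m n r : nat} (A : 'M[K]_(m, n))
    (f : 'I_r -> 'I_m) (g : 'I_r -> 'I_n) (i : 'I_r) (j : 'I_n) :
  mxsub f g A \in unitmx ->
  (invmx (mxsub f g A) *m rowsub f A) i j * \det (mxsub f g A)
  = \det (mxsub f [eta g with i |-> j] A).
Proof.
move=> uB; rewrite {1}/invmx uB -scalemxAl mxE mulrAC mulVf ?mul1r; last first.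
  by rewrite -unitfE -unitmxE.
rewrite (expand_det_col _ i) mxE; apply: eq_bigr => l _.
rewrite !mxE /= eqxx mulrC /cofactor; congr (_ * (_ * \det _)).
by apply/matrixP => a b; rewrite !mxE /= eq_sym (negPf (neq_lift _ _)).
Qed.

Section Modulus.
Context {R : realType} {k : scalar_kind}.
Implicit Types x y : scalars R k.

Lemma modulus_eq0 x : (modulus x == 0) = (x == 0).
Proof.
case: k x => x; first exact: (@normr_eq0 R R).
rewrite -[RHS](@normr_eq0 _ R[i]%C) /modulus normc_def /=.
by apply/esym; exact: (inj_eq (@complexI R) _ 0).
Qed.

Lemma bounded_rank_factorization {m n : nat} (A : 'M[scalars R k]_(m, n))
    (M : R) :
  (forall i j, modulus (A i j) <= M) ->
  exists (U : 'M_(m, \rank A)) (C : 'M_(\rank A, n)),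
    [/\ U *m C = A, forall i j, modulus (U i j) <= M
      & forall i j, modulus (C i j) <= 1].
Proof.
move=> AM; have [f0 [g0 u0]] := full_rank_minor A.
(* All index functions compete, injective or not, so that column [i] may be replaced freely below;
   repeated indices only give determinant 0. *)
pose F (p : {ffun 'I_(\rank A) -> 'I_m} * {ffun 'I_(\rank A) -> 'I_n}) : R :=
  modulus (\det (mxsub p.1 p.2 A)).
have [[f g] _ /= maxF] := arg_maxP F (erefl : xpredT (finfun f0, finfun g0)).
have Fpos : 0 < F (f, g).
  apply: lt_le_trans (maxF (finfun f0, finfun g0) erefl).
  rewrite lt_def modulus_ge0 modulus_eq0 -unitfE -unitmxE /= andbT.
  by rewrite (_ : mxsub _ _ _ = mxsub f0 g0 A)//; apply/matrixP => i j;
     rewrite !mxE !ffunE.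
have uB : mxsub f g A \in unitmx.
  by rewrite unitmxE unitfE -modulus_eq0 gt_eqF.
exists (colsub g A), (invmx (mxsub f g A) *m rowsub f A); split.
- exact: rank_factorization_of_minor.
- by move=> i j; rewrite mxE.
(* Multiplied by the maximal minor, the entry becomes another competing minor. *)
move=> i j; rewrite -(ler_pM2r Fpos) mul1r -modulusM cramer_mxsub//.
have := maxF (f, finfun [eta g with i |-> j]) erefl.
rewrite /F /= (_ : mxsub _ (finfun _) A = mxsub f [eta g with i |-> j] A)//.
by apply/matrixP => a b; rewrite !mxE ffunE.
Qed.

Lemma modulus_le_euclidean_norm {d : nat} (v : 'cV[scalars R k]_d) i :
  modulus (v i 0) <= euclidean_norm v.
Proof.
rewrite -[leLHS]ger0_norm ?modulus_ge0// -sqrtr_sqr ler_wsqrtr//.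
by rewrite (bigD1 i)//= lerDl sumr_ge0// => ? _; exact: sqr_ge0.
Qed.

Lemma modulus_le_operator_norm {d : nat} (A : 'M[scalars R k]_d) i j :
  modulus (A i j) <= operator_norm A.
Proof.
have modulus1 : modulus (1 : scalars R k) = 1.
  have m1 : modulus (1 : scalars R k) != 0 by rewrite modulus_eq0 oner_eq0.
  by apply: (mulfI m1); rewrite -modulusM !mulr1.
(* The entry is a coordinate of the image of a basis vector, which lies in the unit ball. *)
have -> : A i j = (A *m delta_mx j 0 : 'cV_d) i 0 by rewrite -colE mxE.
apply: le_trans (modulus_le_euclidean_norm _ _) _.
apply: (sup_upper_bound (operator_norm_has_sup A)).
exists (delta_mx j 0) => //=.
rewrite /euclidean_norm (bigD1 j)//= big1 => [|l lj].
  by rewrite mxE !eqxx modulus1 addr0 expr1n sqrtr1.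
by rewrite mxE (negPf lj) modulus0 expr0n.
Qed.

Lemma operator_norm_le_entries {d : nat} (A : 'M[scalars R k]_d) (M : R) :
  (forall i j, modulus (A i j) <= M) ->
  operator_norm A <= Num.sqrt (\sum_(i < d) (\sum_(j < d) M) ^+ 2).
Proof.
move=> AM; apply: ge_sup; first by have [] := operator_norm_has_sup A.
move=> _ [v /= v1 <-].
have vj j := le_trans (modulus_le_euclidean_norm v j) v1.
rewrite ler_wsqrtr//; apply: ler_sum => i _.
have le_sum : modulus ((A *m v) i 0) <= \sum_(j < d) M.
  rewrite mxE; elim/big_rec2: _ => [|j x y _ le_yx]; first by rewrite modulus0.
  apply: le_trans (ler_modulusD _ _) _; rewrite lerD// modulusM.
  by apply: le_trans (AM i j); rewrite ler_piMr// modulus_ge0.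
(* [M] has no assumed sign; the sum is nonnegative because it dominates a modulus. *)
rewrite lerXn2r// nnegrE ?modulus_ge0//.
by apply: le_trans le_sum; exact: modulus_ge0.
Qed.

Lemma bounded_idempotent_diagonalization {d : nat} (P : 'M[scalars R k]_d)
    (M : R) :
  1 <= M -> P *m P = P ->
  (forall i j, modulus (P i j) <= M) ->
  (forall i j, modulus ((1%:M - P) i j) <= M) ->
  exists T : 'M[scalars R k]_d,
    [/\ T \in unitmx, invmx T *m P *m T = pid_mx (\rank P),
        forall i j, modulus (T i j) <= M
      & forall i j, modulus (invmx T i j) <= M].
Proof.
move=> M1 PP PM QM.
(* One inequality comes from [P *m (1%:M - P) = 0], the other from subadditivity of the rank. *)
have rPQ : (\rank P + \rank (1%:M - P)%R = d)%N.
  apply/eqP; rewrite eqn_leq; apply/andP; split.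
    by apply: mulmx0_rank_max; rewrite mulmxBr mulmx1 PP subrr.
  rewrite -{1}(mxrank1 (scalars R k) d) -{1}[1%:M](subrK P) addrC.
  exact: mxrank_add.
have [U1 [C1 [UC1 U1M C1M]]] := bounded_rank_factorization _ _ PM.
have [U2 [C2 [UC2 U2M C2M]]] := bounded_rank_factorization _ _ QM.
(* With the ranks generalized, [d] can be replaced by [r + s], which makes the block matrices [T]
   and [S] square. *)
move: (\rank P) (\rank (1%:M - P)) rPQ U1 C1 UC1 U1M C1M U2 C2 UC2 U2M C2M.
move=> r s rs; move: P PP PM QM; case: d / rs => P PP PM QM.
move=> U1 C1 UC1 U1M C1M U2 C2 UC2 U2M C2M.
pose T := row_mx U1 U2; pose S := col_mx C1 C2.
have TS : T *m S = 1%:M by rewrite mul_row_col UC1 UC2 addrC subrK.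
have ST := mulmx1C TS; have [uT uS] := mulmx1_unit TS.
have invT : invmx T = S by rewrite -[LHS]mulmx1 -TS mulKmx.
exists T; rewrite invT; split=> //.
(* The blocks of [S *m T = 1%:M] collapse [S *m (U1 *m C1) *m T] to the diagonal projector. *)
- move: (ST); rewrite mul_col_row scalar_mx_block => /eq_block_mx[C1U1 C1U2 C2U1 _].
  rewrite -UC1 mulmxA mul_col_mx mul_col_mx C1U1 C2U1 mul1mx mul0mx.
  by rewrite mul_col_row C1U1 C1U2 !mul0mx pid_mx_block.
- by move=> i j; rewrite mxE; case: split => l.
- by move=> i j; rewrite mxE; case: split => l; apply: le_trans M1.
Qed.

End Modulus.

Lemma partial_cotranslation_conj {G : groupType} {K : fieldType} {d : nat}
    (W : G -> G -> 'M[K]_d) (T : G -> 'M[K]_d) :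
  partial_cotranslation W -> (forall g, T g \in unitmx) ->
  partial_cotranslation (fun g h => invmx (T (h * g)%g) *m W g h *m T g).
Proof.
by move=> cW uT g h l; rewrite cW mulgA !mulmxA mulmxK.
Qed.

Theorem corollary5p19 (G : groupType) (R : realType) (k : scalar_kind) (d : nat)
    (W : G -> G -> 'M[scalars R k]_d)
    (hW : partial_cotranslation W)
    (hbound : exists M : R, 1 <= M /\
      (ereal_sup (range (fun g => (operator_norm (W g 1%g))%:E)
                  `|` range (fun g => (operator_norm (1%:M - W g 1%g))%:E))
       < M%:E)%E) :
  exists V : G -> G -> 'M[scalars R k]_d,
    [/\ partial_cotranslation V,
        constant_orthogonal_projector V
      & boundedly_conjugated W V].
Proof.
have [M [M1 /ltW supM]] := hbound.
have PM g : operator_norm (W g 1%g) <= M.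
  rewrite -lee_fin; apply: le_trans supM; apply: ereal_sup_ubound.
  by left; exists g.
have QM g : operator_norm (1%:M - W g 1%g) <= M.
  rewrite -lee_fin; apply: le_trans supM; apply: ereal_sup_ubound.
  by right; exists g.
have diagW g : exists T : 'M[scalars R k]_d,
    [/\ T \in unitmx, invmx T *m W g 1%g *m T = pid_mx (cotranslation_rank W),
        forall i j, modulus (T i j) <= M
      & forall i j, modulus (invmx T i j) <= M].
  (* Constancy of the rank gives the same normal form at every [g]. *)
  rewrite -(cotranslation_rankE hW g 1%g).
  apply: bounded_idempotent_diagonalization => //.
  - by have := hW g 1%g 1%g; rewrite !mul1g.
  - by move=> i j; apply: le_trans (modulus_le_operator_norm _ _ _) (PM g).
  - by move=> i j; apply: le_trans (modulus_le_operator_norm _ _ _) (QM g).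
have [T /all_and4[uT diagT TM invTM]] := choice diagW.
(* The target projector is defined by the rank of the new cotranslation, which is read off its value
   at the unit. *)
have rankV : cotranslation_rank (fun g h => invmx (T (h * g)%g) *m W g h *m T g)
    = cotranslation_rank W.
  rewrite {1}/cotranslation_rank mul1g diagT.
  by rewrite rank_pid_mx// rank_leq_row.
exists (fun g h => invmx (T (h * g)%g) *m W g h *m T g); split.
- exact: partial_cotranslation_conj.
- by move=> g; rewrite rankV mul1g diagT.
exists T; split=> //; first by move=> g h; rewrite !mulmxA mulmxV// mul1mx.
(* This bound depends only on [d] and [M], hence is uniform in [g]. *)
pose N := Num.sqrt (\sum_(i < d) (\sum_(j < d) M) ^+ 2).
apply: (@le_lt_trans _ _ N%:E); last exact: ltry.
by apply: ge_ereal_sup => _ [|] [g _ <-]; rewrite lee_fin operator_norm_le_entries.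
Qed.
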